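(* Let $\overline{A_1A_2A_3}$ be any triangle in the plane over a field of characteristic not two, with blue, red and green orthocenters $O_b,O_r,O_g$ and blue, red and green circumcenters $C_b,C_r,C_g$. Then each coloured circumcenter is the midpoint of the two orthocenters of the other two colours: $C_b$ is the midpoint of $O_r$ and $O_g$, $C_r$ is the midpoint of $O_b$ and $O_g$, and $C_g$ is the midpoint of $O_b$ and $O_r$.
   Context: Work over a fixed field not of characteristic two. A point is an ordered pair $[x,y]$ of field elements. A line is a proportion $\langle a:b:c\rangle$ with $a,b$ not both zero; the point $[x,y]$ lies on it precisely when $ax+by+c=0$. Lines $\langle a_1:b_1:c_1\rangle$ and $\langle a_2:b_2:c_2\rangle$ are blue perpendicular when $a_1a_2+b_1b_2=0$, red perpendicular when $a_1a_2-b_1b_2=0$, and green perpendicular when $a_1b_2+b_1a_2=0$. A triangle $\overline{A_1A_2A_3}$ is a set of three distinct non-collinear points. For each colour, the altitude of that colour from a point $A$ to a line $l$ is the unique line through $A$ perpendicular to $l$ in that colour. The orthocenter of a given colour of a triangle is the common point of the three altitudes of that colour from the points of the triangle to the opposite lines. The perpendicular bisector of a given colour of a side $\overline{A_iA_j}$ is the altitude of that colour from the midpoint of $A_i$ and $A_j$ to the line $A_iA_j$, and the circumcenter of a given colour is the common point of the three perpendicular bisectors of that colour. (These common points always exist and are unique.) *)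

(* Defs.v *)
From HB Require Import structures.
From mathcomp Require Import all_boot all_order all_algebra.
From mathcomp Require Import generic_quotient ring.

Set Implicit Arguments.
Unset Strict Implicit.
Unset Printing Implicit Defensive.

Import GRing.Theory.
Local Open Scope ring_scope.
Local Open Scope quotient_scope.

Definition point (F : fieldType) : Type := (F * F)%type.

Definition line_coefs (F : fieldType) : Type :=
  {t : F * F * F | (t.1.1 != 0) || (t.1.2 != 0)}.

(* All 2 x 2 minors vanish; see proportionalP for the usual form. *)
Definition proportional (F : fieldType) (s t : line_coefs F) : bool :=
  let: (a1, b1, c1) := val s in
  let: (a2, b2, c2) := val t in
  [&& a1 * b2 == a2 * b1, a1 * c2 == a2 * c1 & b1 * c2 == b2 * c1].

Lemma proportionalP (F : fieldType) (s t : line_coefs F) :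
  reflect (exists2 k : F, k != 0 &
             val s = (k * (val t).1.1, k * (val t).1.2, k * (val t).2))
          (proportional s t).
Proof.
case: s t => [[[a1 b1] c1] /= h1] [[[a2 b2] c2] /= h2].
rewrite /proportional /=; apply: (iffP and3P) => [[/eqP ab /eqP ac /eqP bc]|].
- have [a20|a20] := eqVneq a2 0.
    move: h2; rewrite a20 eqxx /= => b20.
    have a10 : a1 = 0 by apply: (mulIf b20); rewrite ab a20; ring.
    move: h1; rewrite a10 eqxx /= => b10.
    exists (b1 / b2); first by rewrite mulf_neq0 ?invr_eq0.
    congr (_, _, _); rewrite ?mulr0 ?divfK //.
    by apply: (mulIf b20); rewrite mulrAC divfK // bc mulrC.
  have a10 : a1 != 0.
    apply/eqP => a10; move: h1; rewrite a10 eqxx /= => /eqP; apply.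
    by apply: (mulfI a20); rewrite -ab a10; ring.
  exists (a1 / a2); first by rewrite mulf_neq0 ?invr_eq0.
  congr (_, _, _); rewrite ?divfK //.
    by apply: (mulIf a20); rewrite mulrAC divfK // ab mulrC.
  by apply: (mulIf a20); rewrite mulrAC divfK // ac mulrC.
- by case=> k k0 [-> -> ->]; split; apply/eqP; ring.
Qed.

Lemma proportional_refl (F : fieldType) : reflexive (@proportional F).
Proof. by move=> [[[a b] c] h]; rewrite /proportional /= !eqxx. Qed.

Lemma proportional_sym (F : fieldType) : symmetric (@proportional F).
Proof.
move=> [[[a1 b1] c1] h1] [[[a2 b2] c2] h2]; rewrite /proportional /=.
by rewrite (eq_sym (a1 * b2)) (eq_sym (a1 * c2)) (eq_sym (b1 * c2)).
Qed.

Lemma proportional_trans (F : fieldType) : transitive (@proportional F).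
Proof.
move=> t s u /proportionalP[k k0 st] /proportionalP[k' k0' tu].
apply/proportionalP; exists (k * k'); first exact: mulf_neq0.
by rewrite st tu /= !mulrA.
Qed.

Canonical proportional_equiv (F : fieldType) :=
  EquivRel (@proportional F) (@proportional_refl F) (@proportional_sym F)
           (@proportional_trans F).

(* <a : b : c>, equal up to a common nonzero factor. on_line and perp below read
   the coefficients of repr; on_mk_line and perp_mk_line show that they do not
   depend on the representative. *)
Definition line (F : fieldType) : Type := {eq_quot (@proportional F)}.

Definition mk_line (F : fieldType) (a b c : F) (h : (a != 0) || (b != 0)) :
    line F :=
  (\pi_(line F) (exist _ (a, b, c) h))%qT.

Lemma mk_line_repr (F : fieldType) (a b c : F) (h : (a != 0) || (b != 0)) :
  exists2 k, k != 0 &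
    val (repr (mk_line c h)) = (k * a, k * b, k * c).
Proof.
have /eqmodP/proportionalP[k k0 e] :
  (repr (mk_line c h) = exist _ (a, b, c) h %[mod line F])%qT by rewrite reprK.
by exists k.
Qed.

Lemma mk_lineK (F : fieldType) (l : line F) :
  exists a b c (h : (a != 0) || (b != 0)), l = mk_line c h.
Proof.
elim/quotW: l => -[[[a b] c] h].
by exists a, b, c, h.
Qed.

Definition on_line (F : fieldType) (l : line F) (A : point F) : bool :=
  let: (a, b, c) := val (repr l) in a * A.1 + b * A.2 + c == 0.

Lemma on_mk_line (F : fieldType) (a b c : F) (h : (a != 0) || (b != 0))
    (A : point F) :
  on_line (mk_line c h) A = (a * A.1 + b * A.2 + c == 0).
Proof.
rewrite /on_line; have [k k0 ->] := mk_line_repr c h.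
by rewrite -!mulrA -!mulrDr mulf_eq0 (negPf k0).
Qed.

Inductive colour : Set := Blue | Red | Green.

Definition perp_form (F : fieldType) (col : colour) (a1 b1 a2 b2 : F) : F :=
  match col with
  | Blue => a1 * a2 + b1 * b2
  | Red => a1 * a2 - b1 * b2
  | Green => a1 * b2 + b1 * a2
  end.

Definition perp (F : fieldType) (col : colour) (l1 l2 : line F) : bool :=
  let: (a1, b1, c1) := val (repr l1) in
  let: (a2, b2, c2) := val (repr l2) in
  perp_form col a1 b1 a2 b2 == 0.

Lemma perp_mk_line (F : fieldType) (col : colour) (a1 b1 c1 a2 b2 c2 : F)
    (h1 : (a1 != 0) || (b1 != 0)) (h2 : (a2 != 0) || (b2 != 0)) :
  perp col (mk_line c1 h1) (mk_line c2 h2) = (perp_form col a1 b1 a2 b2 == 0).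
Proof.
rewrite /perp; have [k k0 ->] := mk_line_repr c1 h1.
have [k' k0' ->] := mk_line_repr c2 h2.
have -> : perp_form col (k * a1) (k * b1) (k' * a2) (k' * b2)
          = (k * k') * perp_form col a1 b1 a2 b2 by case: col => /=; ring.
by rewrite !mulf_eq0 (negPf k0) (negPf k0').
Qed.

Lemma join_exists (F : fieldType) (A B : point F) :
  A != B -> exists l : line F, on_line l A && on_line l B.
Proof.
case: A B => [x1 y1] [x2 y2] AB.
have h : (y1 - y2 != 0) || (x2 - x1 != 0).
  apply: contraNT AB; rewrite negb_or !negbK !subr_eq0.
  by move=> /andP[/eqP -> /eqP ->].
exists (mk_line (x1 * y2 - x2 * y1) h); rewrite !on_mk_line /=.
by apply/andP; split; apply/eqP; ring.
Qed.

Definition join (F : fieldType) (A B : point F) (AB : A != B) : line F :=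
  xchoose (join_exists AB).

Lemma joinP (F : fieldType) (A B : point F) (AB : A != B) :
  on_line (join AB) A && on_line (join AB) B.
Proof. exact: (xchooseP (join_exists AB)). Qed.

Lemma join_unique (F : fieldType) (A B : point F) (AB : A != B) (l : line F) :
  on_line l A -> on_line l B -> l = join AB.
Proof.
have := joinP AB; move: (join AB) => m.
case: A B AB => [x1 y1] [x2 y2] AB.
have [a [b [c [h ->]]]] := mk_lineK l.
have [a' [b' [c' [h' ->]]]] := mk_lineK m.
rewrite !on_mk_line /= => /andP[/eqP e1' /eqP e2'] /eqP e1 /eqP e2.
have Ec : c = - (a * x1 + b * y1) by apply/eqP; rewrite -addr_eq0 addrC e1.
have Ec' : c' = - (a' * x1 + b' * y1) by apply/eqP; rewrite -addr_eq0 addrC e1'.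
have P : a * (x2 - x1) = - b * (y2 - y1).
  by apply/eqP; rewrite -subr_eq0 -e2 Ec; apply/eqP; ring.
have P' : a' * (x2 - x1) = - b' * (y2 - y1).
  by apply/eqP; rewrite -subr_eq0 -e2' Ec'; apply/eqP; ring.
have ab : a * b' = a' * b.
  have [x12|x12] := eqVneq (x2 - x1) 0.
    have y12 : y2 - y1 != 0.
      move: x12 AB => /eqP; rewrite !subr_eq0 => /eqP ->.
      by apply: contraNneq => ->.
    apply: (mulIf y12).
    have -> : a * b' * (y2 - y1) = - (a * (- b' * (y2 - y1))) by ring.
    have -> : a' * b * (y2 - y1) = - (a' * (- b * (y2 - y1))) by ring.
    by rewrite -P -P'; ring.
  apply: (mulIf x12).
  have -> : a * b' * (x2 - x1) = b' * (a * (x2 - x1)) by ring.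
  have -> : a' * b * (x2 - x1) = b * (a' * (x2 - x1)) by ring.
  by rewrite P P'; ring.
apply/eqmodP; rewrite /= /proportional /= ab eqxx Ec Ec' /=.
apply/andP; split; rewrite -subr_eq0.
  have -> : a * - (a' * x1 + b' * y1) - a' * - (a * x1 + b * y1)
          = - y1 * (a * b' - a' * b) by ring.
  by rewrite ab subrr mulr0.
have -> : b * - (a' * x1 + b' * y1) - b' * - (a * x1 + b * y1)
          = x1 * (a * b' - a' * b) by ring.
by rewrite ab subrr mulr0.
Qed.

Lemma altitude_exists (F : fieldType) (col : colour) (A : point F)
    (l : line F) :
  exists m : line F, on_line m A && perp col m l.
Proof.
have [a [b [c [h ->]]]] := mk_lineK l; case: A => [x y].
case: col.
- have h' : (- b != 0) || (a != 0) by rewrite oppr_eq0 orbC.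
  exists (mk_line (b * x - a * y) h'); rewrite on_mk_line perp_mk_line /=.
  by apply/andP; split; apply/eqP; ring.
- have h' : (b != 0) || (a != 0) by rewrite orbC.
  exists (mk_line (- (b * x + a * y)) h'); rewrite on_mk_line perp_mk_line /=.
  by apply/andP; split; apply/eqP; ring.
- have h' : (a != 0) || (- b != 0) by rewrite oppr_eq0.
  exists (mk_line (b * y - a * x) h'); rewrite on_mk_line perp_mk_line /=.
  by apply/andP; split; apply/eqP; ring.
Qed.

Definition altitude (F : fieldType) (col : colour) (A : point F) (l : line F) :
    line F :=
  xchoose (altitude_exists col A l).

Lemma altitudeP (F : fieldType) (col : colour) (A : point F) (l : line F) :
  on_line (altitude col A l) A && perp col (altitude col A l) l.
Proof. exact: (xchooseP (altitude_exists col A l)). Qed.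

Lemma altitude_unique (F : fieldType) (col : colour) (A : point F)
    (l m : line F) :
  on_line m A -> perp col m l -> m = altitude col A l.
Proof.
have := altitudeP col A l; move: (altitude col A l) => n; case: A => [x y].
have [a [b [c [h ->]]]] := mk_lineK l.
have [a1 [b1 [c1 [h1 ->]]]] := mk_lineK m.
have [a2 [b2 [c2 [h2 ->]]]] := mk_lineK n.
rewrite !on_mk_line !perp_mk_line /= => /andP[/eqP e2 /eqP p2] /eqP e1 /eqP p1.
have E1 : c1 = - (a1 * x + b1 * y) by apply/eqP; rewrite -addr_eq0 addrC e1.
have E2 : c2 = - (a2 * x + b2 * y) by apply/eqP; rewrite -addr_eq0 addrC e2.
have ab : a1 * b2 = a2 * b1.
  apply/eqP; rewrite -subr_eq0.
  have Da : a * (a1 * b2 - a2 * b1) = 0.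
    case: col p1 p2 => /= p1 p2.
    - have -> : a * (a1 * b2 - a2 * b1)
        = b2 * (a1 * a + b1 * b) - b1 * (a2 * a + b2 * b) by ring.
      by rewrite p1 p2; ring.
    - have -> : a * (a1 * b2 - a2 * b1)
        = b2 * (a1 * a - b1 * b) - b1 * (a2 * a - b2 * b) by ring.
      by rewrite p1 p2; ring.
    - have -> : a * (a1 * b2 - a2 * b1)
        = a1 * (a2 * b + b2 * a) - a2 * (a1 * b + b1 * a) by ring.
      by rewrite p1 p2; ring.
  have Db : b * (a1 * b2 - a2 * b1) = 0.
    case: col p1 p2 => /= p1 p2.
    - have -> : b * (a1 * b2 - a2 * b1)
        = a1 * (a2 * a + b2 * b) - a2 * (a1 * a + b1 * b) by ring.
      by rewrite p1 p2; ring.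
    - have -> : b * (a1 * b2 - a2 * b1)
        = a2 * (a1 * a - b1 * b) - a1 * (a2 * a - b2 * b) by ring.
      by rewrite p1 p2; ring.
    - have -> : b * (a1 * b2 - a2 * b1)
        = b2 * (a1 * b + b1 * a) - b1 * (a2 * b + b2 * a) by ring.
      by rewrite p1 p2; ring.
  case/orP: h => h0; last by move/eqP: Db; rewrite mulf_eq0 (negPf h0).
  by move/eqP: Da; rewrite mulf_eq0 (negPf h0).
apply/eqmodP; rewrite /= /proportional /= ab eqxx E1 E2 /=.
apply/andP; split; rewrite -subr_eq0.
  have -> : a1 * - (a2 * x + b2 * y) - a2 * - (a1 * x + b1 * y)
          = - y * (a1 * b2 - a2 * b1) by ring.
  by rewrite ab subrr mulr0.
have -> : b1 * - (a2 * x + b2 * y) - b2 * - (a1 * x + b1 * y)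
          = x * (a1 * b2 - a2 * b1) by ring.
by rewrite ab subrr mulr0.
Qed.

(* A triangle as a set of points is such a record up to relabelling of the
   vertices. *)
Record triangle (F : fieldType) := Triangle {
  vtx1 : point F;
  vtx2 : point F;
  vtx3 : point F;
  vtx12 : vtx1 != vtx2;
  vtx23 : vtx2 != vtx3;
  vtx31 : vtx3 != vtx1;
  vtx_noncollinear :
    ~ exists l : line F, [/\ on_line l vtx1, on_line l vtx2 & on_line l vtx3]
}.

(* In characteristic two 2^-1 = 0, so this is a midpoint only when 2 != 0. *)
Definition midpoint (F : fieldType) (A B : point F) : point F :=
  ((A.1 + B.1) / 2%:R, (A.2 + B.2) / 2%:R).

Lemma on_altitude_join (F : fieldType) (col : colour) (A B C P : point F)
    (BC : B != C) :
  on_line (altitude col A (join BC)) P =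
  (perp_form col (C.1 - B.1) (C.2 - B.2) (P.1 - A.1) (P.2 - A.2) == 0).
Proof.
case: A B C P BC => [x1 y1] [x2 y2] [x3 y3] [x y] BC /=.
have h : (y2 - y3 != 0) || (x3 - x2 != 0).
  apply: contraNT BC; rewrite negb_or !negbK !subr_eq0.
  by move=> /andP[/eqP -> /eqP ->].
have <- : mk_line (x2 * y3 - x3 * y2) h = join BC.
  by apply: join_unique; rewrite on_mk_line; apply/eqP => /=; ring.
case: col => /=.
- have h' : (x3 - x2 != 0) || (y3 - y2 != 0).
    by rewrite -(oppr_eq0 (y3 - y2)) opprB orbC.
  have <- : mk_line (- ((x3 - x2) * x1 + (y3 - y2) * y1)) h'
            = altitude Blue (x1, y1) (mk_line (x2 * y3 - x3 * y2) h).
    by apply: altitude_unique; rewrite ?on_mk_line ?perp_mk_line;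
      apply/eqP => /=; ring.
  by rewrite on_mk_line /=; congr (_ == _); ring.
- have h' : (x3 - x2 != 0) || (y2 - y3 != 0) by rewrite orbC.
  have <- : mk_line (- ((x3 - x2) * x1 + (y2 - y3) * y1)) h'
            = altitude Red (x1, y1) (mk_line (x2 * y3 - x3 * y2) h).
    by apply: altitude_unique; rewrite ?on_mk_line ?perp_mk_line;
      apply/eqP => /=; ring.
  by rewrite on_mk_line /=; congr (_ == _); ring.
- have h' : (y3 - y2 != 0) || (x3 - x2 != 0).
    by rewrite -(oppr_eq0 (y3 - y2)) opprB.
  have <- : mk_line (- ((y3 - y2) * x1 + (x3 - x2) * y1)) h'
            = altitude Green (x1, y1) (mk_line (x2 * y3 - x3 * y2) h).
    by apply: altitude_unique; rewrite ?on_mk_line ?perp_mk_line;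
      apply/eqP => /=; ring.
  by rewrite on_mk_line /=; congr (_ == _); ring.
Qed.

Lemma triangle_det (F : fieldType) (T : triangle F) :
  ((vtx3 T).1 - (vtx2 T).1) * ((vtx1 T).2 - (vtx3 T).2)
  - ((vtx3 T).2 - (vtx2 T).2) * ((vtx1 T).1 - (vtx3 T).1) != 0.
Proof.
case: T => [[x1 y1] [x2 y2] [x3 y3] n12 n23 n31 nc] /=.
apply/negP => /eqP D; apply: nc.
have h : (y2 - y3 != 0) || (x3 - x2 != 0).
  apply: contraNT n23; rewrite negb_or !negbK !subr_eq0.
  by move=> /andP[/eqP -> /eqP ->].
exists (mk_line (x2 * y3 - x3 * y2) h).
split; rewrite on_mk_line /=; apply/eqP; last 2 first; try ring.
by rewrite -[RHS]D; ring.
Qed.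

Lemma perp_form_solve (F : fieldType) (col : colour) (u1 u2 v1 v2 s t : F) :
  u1 * v2 - u2 * v1 != 0 ->
  exists P : point F,
    perp_form col u1 u2 P.1 P.2 = s /\ perp_form col v1 v2 P.1 P.2 = t.
Proof.
move=> D.
pose p := (s * v2 - t * u2) / (u1 * v2 - u2 * v1).
pose q := (u1 * t - v1 * s) / (u1 * v2 - u2 * v1).
case: col; [exists (p, q) | exists (p, - q) | exists (q, p)];
  by rewrite /p /q /=; split; field.
Qed.

Lemma perp_form_inj (F : fieldType) (col : colour) (u1 u2 v1 v2 : F)
    (P Q : point F) :
  u1 * v2 - u2 * v1 != 0 ->
  perp_form col u1 u2 (P.1 - Q.1) (P.2 - Q.2) = 0 ->
  perp_form col v1 v2 (P.1 - Q.1) (P.2 - Q.2) = 0 -> P = Q.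
Proof.
case: P Q => [p1 p2] [q1 q2] /= D.
set d := p1 - q1; set e := p2 - q2 => eu ev.
suff [d0 e0] : d = 0 /\ e = 0 by rewrite (subr0_eq d0) (subr0_eq e0).
case: col eu ev => /= eu ev.
- split; apply: (mulfI D); rewrite mulr0.
    have -> : (u1 * v2 - u2 * v1) * d
      = v2 * (u1 * d + u2 * e) - u2 * (v1 * d + v2 * e) by ring.
    by rewrite eu ev; ring.
  have -> : (u1 * v2 - u2 * v1) * e
    = u1 * (v1 * d + v2 * e) - v1 * (u1 * d + u2 * e) by ring.
  by rewrite eu ev; ring.
- split; apply: (mulfI D); rewrite mulr0.
    have -> : (u1 * v2 - u2 * v1) * d
      = v2 * (u1 * d - u2 * e) - u2 * (v1 * d - v2 * e) by ring.
    by rewrite eu ev; ring.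
  have -> : (u1 * v2 - u2 * v1) * e
    = v1 * (u1 * d - u2 * e) - u1 * (v1 * d - v2 * e) by ring.
  by rewrite eu ev; ring.
- split; apply: (mulfI D); rewrite mulr0.
    have -> : (u1 * v2 - u2 * v1) * d
      = u1 * (v1 * e + v2 * d) - v1 * (u1 * e + u2 * d) by ring.
    by rewrite eu ev; ring.
  have -> : (u1 * v2 - u2 * v1) * e
    = v2 * (u1 * e + u2 * d) - u2 * (v1 * e + v2 * d) by ring.
  by rewrite eu ev; ring.
Qed.

Lemma perps_concur (F : fieldType) (col : colour) (T : triangle F)
    (M1 M2 M3 : point F) :
  (forall P : point F,
    perp_form col ((vtx3 T).1 - (vtx2 T).1) ((vtx3 T).2 - (vtx2 T).2)
      (P.1 - M1.1) (P.2 - M1.2)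
    + perp_form col ((vtx1 T).1 - (vtx3 T).1) ((vtx1 T).2 - (vtx3 T).2)
      (P.1 - M2.1) (P.2 - M2.2)
    + perp_form col ((vtx2 T).1 - (vtx1 T).1) ((vtx2 T).2 - (vtx1 T).2)
      (P.1 - M3.1) (P.2 - M3.2) = 0) ->
  exists P : point F,
    [&& on_line (altitude col M1 (join (vtx23 T))) P,
        on_line (altitude col M2 (join (vtx31 T))) P &
        on_line (altitude col M3 (join (vtx12 T))) P].
Proof.
move=> sum0.
have [P [e1 e2]] := perp_form_solve col
  (perp_form col ((vtx3 T).1 - (vtx2 T).1) ((vtx3 T).2 - (vtx2 T).2) M1.1 M1.2)
  (perp_form col ((vtx1 T).1 - (vtx3 T).1) ((vtx1 T).2 - (vtx3 T).2) M2.1 M2.2)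
  (triangle_det T).
have formB (a b c d c' d' : F) : perp_form col a b (c - c') (d - d')
    = perp_form col a b c d - perp_form col a b c' d'.
  by case: col {sum0 e1 e2} => /=; ring.
exists P; rewrite !on_altitude_join.
have := sum0 P; rewrite !formB e1 e2 !subrr !add0r => ->.
by rewrite eqxx.
Qed.

Lemma perps_meet_once (F : fieldType) (col : colour) (T : triangle F)
    (M1 M2 P Q : point F) :
  on_line (altitude col M1 (join (vtx23 T))) P ->
  on_line (altitude col M2 (join (vtx31 T))) P ->
  on_line (altitude col M1 (join (vtx23 T))) Q ->
  on_line (altitude col M2 (join (vtx31 T))) Q -> P = Q.
Proof.
rewrite !on_altitude_join => /eqP p1 /eqP p2 /eqP q1 /eqP q2.
have formB (a b c d c' d' m n : F) :
    perp_form col a b (c - c') (d - d')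
    = perp_form col a b (c - m) (d - n) - perp_form col a b (c' - m) (d' - n).
  by case: col {p1 p2 q1 q2} => /=; ring.
apply: (perp_form_inj (col := col) (triangle_det T)).
  by rewrite (formB _ _ _ _ _ _ M1.1 M1.2) p1 q1 subrr.
by rewrite (formB _ _ _ _ _ _ M2.1 M2.2) p2 q2 subrr.
Qed.

Definition is_orthocenter (F : fieldType) (col : colour) (T : triangle F)
    (O : point F) : bool :=
  [&& on_line (altitude col (vtx1 T) (join (vtx23 T))) O,
      on_line (altitude col (vtx2 T) (join (vtx31 T))) O &
      on_line (altitude col (vtx3 T) (join (vtx12 T))) O].

Lemma orthocenter_exists (F : fieldType) (col : colour) (T : triangle F) :
  exists O : point F, is_orthocenter col T O.
Proof. by apply: perps_concur => P; case: col => /=; ring. Qed.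

Definition orthocenter (F : fieldType) (col : colour) (T : triangle F) :
    point F :=
  xchoose (orthocenter_exists col T).

Lemma orthocenterP (F : fieldType) (col : colour) (T : triangle F) :
  is_orthocenter col T (orthocenter col T).
Proof. exact: (xchooseP (orthocenter_exists col T)). Qed.

Lemma orthocenter_unique (F : fieldType) (col : colour) (T : triangle F)
    (O : point F) :
  is_orthocenter col T O -> O = orthocenter col T.
Proof.
case/and3P => o1 o2 _; case/and3P: (orthocenterP col T) => o1' o2' _.
exact: perps_meet_once o1 o2 o1' o2'.
Qed.

Definition perp_bisector (F : fieldType) (col : colour) (A B : point F)
    (AB : A != B) : line F :=
  altitude col (midpoint A B) (join AB).

Definition is_circumcenter (F : fieldType) (col : colour) (T : triangle F)
    (C : point F) : bool :=
  [&& on_line (perp_bisector col (vtx23 T)) C,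
      on_line (perp_bisector col (vtx31 T)) C &
      on_line (perp_bisector col (vtx12 T)) C].

Lemma circumcenter_exists (F : fieldType) (col : colour) (T : triangle F) :
  exists C : point F, is_circumcenter col T C.
Proof.
apply: perps_concur => P; rewrite /midpoint /=.
by move: (2%:R^-1 : F) => h; case: col => /=; ring.
Qed.

Definition circumcenter (F : fieldType) (col : colour) (T : triangle F) :
    point F :=
  xchoose (circumcenter_exists col T).

Lemma circumcenterP (F : fieldType) (col : colour) (T : triangle F) :
  is_circumcenter col T (circumcenter col T).
Proof. exact: (xchooseP (circumcenter_exists col T)). Qed.

Lemma circumcenter_unique (F : fieldType) (col : colour) (T : triangle F)
    (C : point F) :
  is_circumcenter col T C -> C = circumcenter col T.
Proof.
case/and3P => o1 o2 _; case/and3P: (circumcenterP col T) => o1' o2' _.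
exact: perps_meet_once o1 o2 o1' o2'.
Qed.

(* Main.v *)
(* By Cramer's rule every orthocenter is a rational function of the vertices,
   with denominator twice the signed area of the triangle. The midpoint of two
   orthocenters then satisfies the equations of the three perpendicular bisectors
   of the third colour identically, so it is that circumcenter by uniqueness. *)
Require Import Defs.
From mathcomp Require Import all_boot all_order all_algebra.
From mathcomp Require Import ring.

Set Implicit Arguments.
Unset Strict Implicit.
Unset Printing Implicit Defensive.

Import GRing.Theory.
Local Open Scope ring_scope.

(* The right-hand side is the witness of perp_form_solve, for the altitudes from
   the first two vertices. *)
Lemma orthocenter_cramer (F : fieldType) (col : colour) (T : triangle F) :
  let u1 := (vtx3 T).1 - (vtx2 T).1 in let u2 := (vtx3 T).2 - (vtx2 T).2 in
  let v1 := (vtx1 T).1 - (vtx3 T).1 in let v2 := (vtx1 T).2 - (vtx3 T).2 in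
  let s := perp_form col u1 u2 (vtx1 T).1 (vtx1 T).2 in
  let t := perp_form col v1 v2 (vtx2 T).1 (vtx2 T).2 in
  let p := (s * v2 - t * u2) / (u1 * v2 - u2 * v1) in
  let q := (u1 * t - v1 * s) / (u1 * v2 - u2 * v1) in
  orthocenter col T =
    match col with Blue => (p, q) | Red => (p, - q) | Green => (q, p) end.
Proof.
move=> /=; apply/esym/orthocenter_unique; have := triangle_det T.
rewrite /is_orthocenter !on_altitude_join.
case: T => [[x1 y1] [x2 y2] [x3 y3] _ _ _ _] /= D.
(* Negating the second coordinate (red) or swapping coordinates (green) turns the form into the blue
   one, so one Cramer formula serves all; [D] makes its denominator nonzero. *)
by case: col => /=; apply/and3P; split; apply/eqP; field.
Qed.

Theorem theorem15 (F : fieldType) (char_neq2 : 2%N \notin [pchar F]%R)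
    (T : triangle F) :
  [/\ circumcenter Blue T =
         midpoint (orthocenter Red T) (orthocenter Green T),
      circumcenter Red T =
         midpoint (orthocenter Blue T) (orthocenter Green T) &
      circumcenter Green T =
         midpoint (orthocenter Blue T) (orthocenter Red T)].
Proof.
have two0 : 2%:R != 0 :> F by move: char_neq2; rewrite inE.
rewrite !orthocenter_cramer; split; apply/esym/circumcenter_unique;
  have := triangle_det T;
  rewrite /is_circumcenter /perp_bisector !on_altitude_join /midpoint /=;
  case: T => [[x1 y1] [x2 y2] [x3 y3] _ _ _ _] /= D;
  (* The denominators to clear are 2, from the midpoints, and the determinant in [D], from the
     orthocenters. *)
  by apply/and3P; split; apply/eqP; field; rewrite two0.
Qed.
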